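(* Let $G$ be a finite group such that the common non-zero graph $\Gamma_{nv}(G)$ is a star. Then $G$ has exactly one non-linear irreducible character.
   Context: Characters are complex characters of finite groups. $\mathrm{Irr}(G)$ is the set of irreducible characters of $G$. For a character $\chi$ of $G$, $\mathrm{Van}(\chi)=\{g\in G:\chi(g)=0\}$, and $\mathrm{Van}(G)=\bigcup_{\chi\in\mathrm{Irr}(G)}\mathrm{Van}(\chi)$. The common non-zero graph $\Gamma_{nv}(G)$ is the simple graph whose vertices are the non-linear irreducible characters of $G$ (those of degree greater than $1$); two distinct vertices $\chi_1,\chi_2$ are adjacent if and only if there is $g\in\mathrm{Van}(G)$ with $\chi_1(g)\chi_2(g)\neq 0$. A star (of order $n\geq 1$) is a tree on $n$ vertices with one vertex of degree $n-1$ and the other $n-1$ vertices of degree $1$; in particular a star of order $1$ is a graph with exactly one vertex. *)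

(* Defs.v *)
From mathcomp Require Import all_boot all_order all_algebra all_fingroup.
From mathcomp Require Import all_solvable all_field all_character.

Set Implicit Arguments.
Unset Strict Implicit.
Unset Printing Implicit Defensive.

Import Order.TTheory GRing.Theory Num.Theory.
Local Open Scope ring_scope.

(* A simple graph on a finite vertex type is given by its adjacency relation,
   assumed symmetric and irreflexive in what follows. *)
Section SimpleGraphs.

Variables (T : finType) (e : rel T).

Definition graph_degree (x : T) : nat := #|[set y | e x y]|.

Definition graph_connected : Prop := forall x y : T, connect e x y.

(* [ucycle] also accepts sequences of length at most 2, such as an edge
   traversed back and forth; these are not cycles of a simple graph. *)
Definition graph_acyclic : Prop :=
  forall c : seq T, ucycle e c -> (size c < 3)%N.

Definition is_tree : Prop :=
  [/\ (0 < #|T|)%N, graph_connected & graph_acyclic].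

(* For #|T| = 1 the conditions on degrees hold vacuously, apart from the centre
   having degree 0. *)
Definition is_star : Prop :=
  is_tree /\
  exists c : T, graph_degree c = #|T|.-1 /\
                forall x : T, x != c -> graph_degree x = 1%N.

End SimpleGraphs.

Section CommonNonZeroGraph.

Variables (gT : finGroupType) (G : {group gT}).

(* Class functions on G take the value 0 outside G by convention, hence the explicit
   restriction to elements of G. *)
Definition van (chi : 'CF(G)) : {set gT} := [set g in G | chi g == 0].

Definition vanG : {set gT} := \bigcup_(i : Iirr G) van 'chi_i.

Definition nonlinear_irr : pred (Iirr G) := fun i => 1 < 'chi_i 1%g.

Definition nv_vertex : finType := {i : Iirr G | nonlinear_irr i}.

Definition nv_adj : rel nv_vertex := fun u v =>
  (u != v) && [exists g in vanG, 'chi_(val u) g * 'chi_(val v) g != 0].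

Lemma nv_adj_sym : symmetric nv_adj.
Proof.
move=> u v; rewrite /nv_adj eq_sym; congr (_ && _).
by apply: eq_existsb => g; rewrite mulrC.
Qed.

Lemma nv_adj_irr : irreflexive nv_adj.
Proof. by move=> u; rewrite /nv_adj eqxx. Qed.

End CommonNonZeroGraph.

Arguments nv_adj {gT} G.

(* Main.v *)
Require Import Defs.
From mathcomp Require Import all_boot all_order all_algebra all_fingroup.
From mathcomp Require Import all_solvable all_field all_character.
From mathcomp Require Import zify.

(** Suppose the star has more than one vertex, and let c be its centre. Two
    nonlinear irreducible characters with the same zeros are equal; applied to
    complex conjugates and to products with linear characters, this shows that
    every nonlinear character is real and vanishes off K = G'. Write m = |G : K|.
    Each leaf l has a witness g in Van(G) with c(g) l(g) <> 0, at which all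
    other leaves vanish, so column orthogonality gives c(g) c(g') = -m for
    witnesses of two different leaves. Since c is real there are exactly two
    leaves (with one leaf, no character could vanish at its witness). Column
    orthogonality in quotients G / N now shows that K is a minimal normal
    subgroup, and Burnside's vanishing theorem gives m > 1.

    If K is abelian, it is a q-group on which the orbits of linear characters
    have size prime to q, so that no irreducible character of G supported on K
    has a zero in K: contradiction. If K is nonabelian, it is perfect, and
    Thompson's argument on degrees prime to p shows that m is prime to |K|.
    Moreover K is the union of four classes of G, while |K| has three distinct
    prime divisors by Burnside. Hence the classes in K - {1} are those of
    elements of three prime orders, their centralisers are the Sylow subgroups
    of K, of orders Q_i = 1 + m w_i with Q_1 Q_2 Q_3 = |K|, and w_i > 1 because
    the characters take integer values and at least two of them are nonzero at
    each element. The class equation 1 = 1/|K| + m/Q_1 + m/Q_2 + m/Q_3 then has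
    no solution. *)

Set Implicit Arguments.
Unset Strict Implicit.
Unset Printing Implicit Defensive.

(* Here [1 = 1 / (Q * R * S) + m / Q + m / R + m / S] with [m / Q < 1 / u], etc.,
   which leaves only [(u, v) = (2, 2)] and [(2, 3)]. *)
Lemma class_equation_unsolvable_sorted (m u v w Q R S : nat) :
    Q = 1 + m * u -> R = 1 + m * v -> S = 1 + m * w ->
    0 < m -> 2 <= u <= v -> v <= w ->
  Q * R * S <> 1 + m * (R * S + Q * S + Q * R).
Proof.
move=> DQ DR DS m_gt0 /andP[u_ge2 le_uv] le_vw eqQRS.
have leQR: Q <= R by rewrite DQ DR leq_add2l leq_mul2l le_uv orbT.
have leRS: R <= S by rewrite DR DS leq_add2l leq_mul2l le_vw orbT.
have Q_ge m' : m' <= u -> 1 + m' * m <= Q.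
  by rewrite DQ mulnC leq_add2l leq_mul2l => ->; rewrite orbT.
have R_ge m' : m' <= v -> 1 + m' * m <= R.
  by rewrite DR mulnC leq_add2l leq_mul2l => ->; rewrite orbT.
have S_ge m' : m' <= w -> 1 + m' * m <= S.
  by rewrite DS mulnC leq_add2l leq_mul2l => ->; rewrite orbT.
have [u_gt2 | u_le2] := ltnP 2 u.
  (* Adding [h1], [h2] and [h3] gives [R * S + Q * S + Q * R <= 3]. *)
  have hQ := Q_ge _ u_gt2; clear - m_gt0 hQ leQR leRS eqQRS.
  have [hR hS]: 1 + 3 * m <= R /\ 1 + 3 * m <= S by lia.
  have h1 := leq_mul hQ (leqnn (R * S)); have h2 := leq_mul hR (leqnn (Q * S)).
  have h3 := leq_mul hS (leqnn (Q * R)).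
  have h4: 1 <= Q * R by rewrite muln_gt0; lia.
  have h5: 1 <= Q * S by rewrite muln_gt0; lia.
  have h6: 1 + 3 * m <= R * S by rewrite -[X in X <= _]mul1n leq_mul //; lia.
  lia.
have Du: u = 2 by lia.
have {}DQ: Q = 1 + 2 * m by rewrite DQ Du mulnC.
have [v_gt3 | v_le3] := ltnP 3 v.
  have hR := R_ge _ v_gt3; clear -m_gt0 DQ hR leRS eqQRS; subst Q.
  have h1 := leq_mul (leqnn m) (leq_mul hR (leqnn S)).
  have h0 := leq0n (m * R).
  have h2 := leq_mul (leqnn R) (leq_trans hR leRS).
  have h3 := leq_mul (leqnn (m * m)) leRS.
  lia.
have [Dv | Dv]: v = 2 \/ v = 3 by lia.
  have {}DR: R = 1 + 2 * m by rewrite DR Dv mulnC.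
  clear - DQ DR m_gt0 eqQRS; rewrite DR -DQ in eqQRS.
  have eqQS: Q * S = 1 + m * Q * Q.
    have: (1 + 2 * m) * (Q * S) = 1 + m * Q * Q + 2 * m * (Q * S).
      by rewrite -DQ; lia.
    lia.
  (* Here [Q] would divide [Q * S - m * Q * Q = 1], but [Q >= 3]. *)
  have [/(leq_mul (leqnn Q)) | /(leq_mul (leqnn Q))] := leqP S (m * Q); lia.
have {}DR: R = 1 + 3 * m by rewrite DR Dv mulnC.
have eqS: S * (m * m + 3 * m + 1) = 6 * m * m * m + 5 * m * m + m + 1.
  by clear - DQ DR eqQRS; subst Q R; lia.
have w_lt6: w < 6.
  rewrite ltnNge; apply/negP => /S_ge /leq_mul/(_ (leqnn (m * m + 3 * m + 1))).
  by have := leq0n (m * m); rewrite eqS; lia.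
(* For [w] equal to 3, 4 or 5, the equation [eqS] reduces to [(6 - w) * m ^ 2 = (3 * w - 4) * m + (w
   + 2)], which bounds [m]. *)
have m_lt20: m < 20.
  rewrite ltnNge; apply/negP=> m_ge20; clear - DS eqS m_ge20 w_lt6 le_vw Dv.
  have h1 := leq_mul m_ge20 (leqnn m).
  have h2 := leq_mul m_ge20 (leqnn (m * m)).
  have w345: w = 3 \/ w = 4 \/ w = 5 by lia.
  by case: w345 => [Dw | [Dw | Dw]]; rewrite DS Dw in eqS; lia.
clear - DS eqS m_gt0 m_lt20 w_lt6 le_vw Dv.
have w345: w = 3 \/ w = 4 \/ w = 5 by lia.
case: w345 => [Dw | [Dw | Dw]]; rewrite DS Dw in eqS.
all: clear - m_gt0 m_lt20 eqS; do 20 (case: m => [|m] in m_gt0 m_lt20 eqS *; first by lia).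
all: by lia.
Qed.

Lemma class_equation_unsolvable (m u v w : nat) :
    0 < m -> 1 < u -> 1 < v -> 1 < w ->
    let Q := 1 + m * u in let R := 1 + m * v in let S := 1 + m * w in
  Q * R * S <> 1 + m * (R * S + Q * S + Q * R).
Proof.
move=> m_gt0 u_gt1 v_gt1 w_gt1 Q R S.
have E := @class_equation_unsolvable_sorted m.
have Euvw := E u v w Q R S erefl erefl erefl m_gt0.
have Euwv := E u w v Q S R erefl erefl erefl m_gt0.
have Evuw := E v u w R Q S erefl erefl erefl m_gt0.
have Evwu := E v w u R S Q erefl erefl erefl m_gt0.
have Ewuv := E w u v S Q R erefl erefl erefl m_gt0.
have Ewvu := E w v u S R Q erefl erefl erefl m_gt0.
clear E; move: Q R S Euvw Euwv Evuw Evwu Ewuv Ewvu => Q R S *.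
by have [uv | vu] := leqP u v; have [vw | wv] := leqP v w; have [uw | wu] := leqP u w; lia.
Qed.

Import Order.TTheory GRing.Theory Num.Theory GroupScope.
Local Open Scope ring_scope.

(** * Congruences of algebraic integers modulo a prime *)

Lemma eqAmodX e n (x y : algC) :
    x \in Aint -> y \in Aint -> (x == y %[mod e])%A ->
  (x ^+ n == y ^+ n %[mod e])%A.
Proof.
move=> Zx Zy exy; elim: n => [|n IHn]; first by rewrite !expr0.
by rewrite !exprS eqAmodM ?rpredX.
Qed.

Lemma eqAmod_exprDn_prime p (x y : algC) : prime p ->
    x \in Aint -> y \in Aint ->
  ((x + y) ^+ p == x ^+ p + y ^+ p %[mod p])%A.
Proof.
case: p => // p p_pr Zx Zy.
rewrite exprDn big_ord_recl big_ord_recr /= bin0 binn subn0 subnn !expr0 mul1r.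
rewrite !mulr1n mulr1 eqAmodDl -[X in eqAmod _ _ X]add0r eqAmodDr.
rewrite eqAmod0 rpred_sum // => i _; rewrite -eqAmod0.
have /dvdnP[k ->]: (p.+1 %| 'C(p.+1, bump 0 i))%N.
  by apply: prime_dvd_bin => //; rewrite /bump /=; case: i => i /=; lia.
by rewrite mulrnA -mulr_natr eqAmodMl0 // rpredMn // rpredM ?rpredX.
Qed.

Lemma eqAmod_sum_exp_prime p k (I : Type) (r : seq I) (F : I -> algC) :
    prime p -> (forall i, F i \in Aint) ->
  ((\sum_(i <- r) F i) ^+ (p ^ k) == \sum_(i <- r) F i ^+ (p ^ k) %[mod p])%A.
Proof.
move=> p_pr ZF; elim: k => [|k IHk].
  by rewrite expn0 expr1 (eq_bigr F) // => i _; rewrite expr1.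
rewrite expnSr exprM.
apply: (@eqAmod_trans _ ((\sum_(i <- r) F i ^+ (p ^ k)) ^+ p)).
  by rewrite eqAmodX ?rpredX ?rpred_sum // => i _; rewrite rpredX.
rewrite [X in eqAmod _ _ X](eq_bigr (fun i => (F i ^+ (p ^ k)) ^+ p)); last first.
  by move=> i _; rewrite exprM.
elim: r {IHk} => [|i r IHr]; first by rewrite !big_nil expr0n eqn0Ngt prime_gt0.
rewrite !big_cons; apply: eqAmod_trans (_ : eqAmod _ _ _).
  by apply: eqAmod_exprDn_prime => //; rewrite ?rpred_sum ?rpredX // => j _; rewrite rpredX.
by rewrite eqAmodDl.
Qed.

(** Additivity of the Frobenius on a sum of [n] ones gives Fermat's little theorem. *)
Lemma eqAmod_nat_exp_prime p k n : prime p ->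
  ((n%:R : algC) ^+ (p ^ k) == n%:R %[mod p])%A.
Proof.
move=> p_pr.
have := eqAmod_sum_exp_prime k (index_enum 'I_n) p_pr (fun=> Aint1).
by under [in X in eqAmod _ _ X]eq_bigr do rewrite expr1n; rewrite sumr_const card_ord.
Qed.

(* Modulo p, [chi g ^+ (p ^ k)] is the sum of the [lambda g ^+ (p ^ k)] over the
   linear constituents lambda of chi on [<[g]>], that is [chi 1]. *)
Lemma char_p_elt_mod (gT : finGroupType) (G : {group gT}) (chi : 'CF(G)) p g :
    prime p -> chi \is a character -> g \in G -> p.-elt g -> chi g = 0 ->
  (p %| chi 1%g)%C.
Proof.
move=> p_pr Nchi Gg /p_natP[k ord_g] chig0.
have sgG: <[g]> \subset G by rewrite cycle_subG.
pose phi := 'Res[<[g]>] chi.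
have phiE: phi = \sum_i '[phi, 'chi_i] *: 'chi_i by exact: cfun_sum_cfdot.
have Nphi: phi \is a character by rewrite cfRes_char.
have lin i: 'chi[<[g]>]_i \is a linear_char.
  exact/char_abelianP/cycle_abelian.
have coef i: exists n, '[phi, 'chi_i] = n%:R.
  by apply/natrP; rewrite Cnat_cfdot_char_irr.
have phig: phi g = 0 by rewrite cfResE ?cycle_id.
have phi1: phi 1%g = chi 1%g by rewrite cfRes1.
have Z i: '[phi, 'chi_i] * 'chi_i g \in Aint.
  by case: (coef i) => n ->; rewrite rpredM ?rpred_nat ?Aint_irr.
have /natrP[n Dn] := Cnat_char1 Nchi.
suffices: (chi 1%g == 0 %[mod p])%A by rewrite Dn eqAmod0_nat dvdC_nat.
rewrite -phi1.
have := eqAmod_sum_exp_prime k (index_enum (Iirr <[g]>)) p_pr Z.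
have <-: phi g = \sum_i '[phi, 'chi_i] * 'chi_i g.
  by rewrite {1}phiE sum_cfunE; apply: eq_bigr => i _; rewrite cfunE.
rewrite phig expr0n expn_eq0 eqn0Ngt prime_gt0 //= eqAmod_sym => /(eqAmod_trans _).
apply; have ->: phi 1%g = \sum_i '[phi, 'chi_i].
  by rewrite {1}phiE sum_cfunE; apply: eq_bigr => i _; rewrite cfunE lin_char1 ?mulr1.
rewrite /eqAmod -sumrB rpred_sum // => i _.
rewrite exprMn -lin_charX ?cycle_id // -ord_g expg_order lin_char1 // mulr1.
case: (coef i) => a ->; rewrite ord_g.
by have := eqAmod_nat_exp_prime k a p_pr; rewrite eqAmod_sym.
Qed.

(** * Orthogonality, quotients and Clifford theory *)

Lemma nonlinear_irrE (gT : finGroupType) (G : {group gT}) (i : Iirr G) :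
  nonlinear_irr i = ('chi_i \isn't a linear_char).
Proof.
rewrite /nonlinear_irr qualifE /= irr_char /= lt_neqAle eq_sym.
by rewrite irr1_degree ler1n irr_degree_gt0 andbT.
Qed.

(** Otherwise column orthogonality makes a sum of squared moduli vanish, although the principal
    character contributes 1. *)
Lemma irr_eq_conjugate (gT : finGroupType) (G : {group gT}) x y :
  x \in G -> y \in G -> (forall i, 'chi[G]_i x = 'chi_i y) -> x \in y ^: G.
Proof.
move=> Gx Gy eq_xy; apply: contraT => notxGy.
have := second_orthogonality_relation x Gy; rewrite (negPf notxGy) mulr0n.
move/eqP; rewrite psumr_eq0 => [/allP/(_ 0 (mem_index_enum _))|i _].
  by rewrite !irr0 !cfun1E Gx Gy conjC1 mulr1 oner_eq0.
by rewrite eq_xy mul_conjC_ge0.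
Qed.

(** The sum is the regular character of [G / N] at a nontrivial coset. *)
Lemma quotient_regular_eq0 (gT : finGroupType) (G N : {group gT}) x :
    N <| G -> x \in G -> x \notin N ->
  \sum_(i | N \subset cfker 'chi[G]_i) 'chi_i 1%g * 'chi_i x = 0.
Proof.
move=> nsNG Gx notNx; have [sNG nNG] := andP nsNG.
rewrite (reindex _ (mod_Iirr_bij nsNG)) /=.
rewrite (eq_bigl xpredT) => [|i]; last by rewrite mod_IirrE ?cfker_mod.
have := second_orthogonality_relation (coset N x) (group1 (G / N)).
rewrite class1G inE.
have -> : (coset N x == 1%g) = false.
  by apply/eqP => /coset_idr; rewrite (negPf notNx) (subsetP nNG) // => /(_ isT).
rewrite mulr0n => sum0; rewrite -[RHS]sum0; apply: eq_bigr => i _.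
rewrite mod_IirrE // !cfModE // morph1 mulrC irr1_degree conjC_nat //.
Qed.

(** As ['chi_i] is supported on [N], its restriction to [N] has norm [#|G : N|]. Clifford's
    decomposition, with ramification [u], gives this norm as [u ^ 2] times the orbit length. *)
Lemma Clifford_index_support (gT : finGroupType) (G N : {group gT}) i j :
    N <| G -> 'chi[G]_i \in 'CF(G, N) -> j \in irr_constt ('Res[N] 'chi_i) ->
  exists u : nat, [/\ (u ^ 2 * #|G : 'I_G['chi_j]| = #|G : N|)%N,
    'Res[N] 'chi_i = u%:R *: (\sum_(xi <- ('chi_j ^: G)%CF) xi)
    & 'chi_i 1%g = (u * #|G : 'I_G['chi_j]|)%:R * 'chi_j 1%g].
Proof.
move=> nsNG suppN constt_j; have [sNG nNG] := andP nsNG.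
have resE := Clifford_Res_sum_cfclass nsNG constt_j.
have /natrP[u Du]: '['Res[N] 'chi_i, 'chi_j] \in Num.nat.
  by rewrite Cnat_cfdot_char_irr ?cfRes_char ?irr_char.
rewrite Du in resE; exists u; split=> //.
  have orth: orthonormal ('chi_j ^: G)%CF.
    apply: sub_orthonormal (irr_orthonormal N); last exact: cfclass_uniq.
    by move=> _ /cfclassP[y _ ->]; rewrite cfConjg_irr ?mem_irr.
  have: '['Res[N] 'chi_i] = #|G : N|%:R.
    have := cfnorm_irr i; rewrite (cfdotEl _ suppN) cfdotE -(Lagrange sNG) natrM invfM.
    rewrite [_^-1 / _]mulrC -mulrA => /(canRL (mulVKf (neq0CiG G N))).
    rewrite mulr1 => <-; congr (_ * _).
    by apply: eq_bigr => x Nx; rewrite !cfResE.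
  rewrite resE cfdotZl cfdotZr cfnorm_orthonormal // size_cfclass conjC_nat.
  by rewrite mulrA -!natrM => /eqP; rewrite eqr_nat => /eqP.
rewrite -(cfRes1 N) resE cfunE sum_cfunE natrM -mulrA; congr (_ * _).
rewrite big_seq (eq_bigr (fun=> 'chi_j 1%g)) => [|_ /cfclassP[y _ ->]]; last first.
  by rewrite cfConjg1.
by rewrite -big_seq big_const_seq count_predT iter_addr_0 size_cfclass mulr_natl.
Qed.

(** Each level set of [F] is stable under [P], so the fixed-point congruence for [p]-groups applies
    to it. *)
Lemma pgroup_sum_fix (aT : finGroupType) (sT : finType) (D P : {group aT})
    (to : action D sT) (p : nat) (F : sT -> nat) :
    p.-group P -> P \subset D -> (forall x a, a \in P -> F (to x a) = F x) ->
  (\sum_x F x = \sum_(x in 'Fix_to(P)) F x %[mod p])%N.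
Proof.
move=> pP sPD F_P; pose N := \max_x F x.
have FN x : (F x < N.+1)%N by rewrite ltnS leq_bigmax.
rewrite (partition_big (fun x => Ordinal (FN x)) predT) //=.
rewrite [in RHS](partition_big (fun x => Ordinal (FN x)) predT) //=.
apply: (big_ind2 (fun a b => a = b %[mod p])) => // [a b c d ab cd|k _].
  by rewrite -modnDm ab cd modnDm.
pose S := [set x | F x == k].
have actS: [acts P, on S | to].
  apply/subsetP=> a Pa; rewrite !inE (subsetP sPD) //=; apply/subsetP=> x.
  by rewrite !inE F_P.
have sumE (Q : pred sT) :
    (\sum_(x | Q x && (F x == k)) F x = #|[pred x | Q x && (F x == k)]| * k)%N.
  by rewrite -sum_nat_const; apply: eq_bigr => x /andP[_ /eqP].
rewrite (sumE predT) (sumE (mem 'Fix_to(P))) -modnMml -[in RHS]modnMml; congr ((_ * _) %% _)%N.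
have -> : #|[pred x | predT x && (F x == k)]| = #|S| by apply: eq_card => x; rewrite !inE.
rewrite (pgroup_fix_mod pP actS); congr (_ %% _)%N; apply: eq_card => x.
by rewrite !inE andbC.
Qed.

(** * The case of an abelian derived subgroup *)

(** For [x] in [K^#], the centraliser ['C_G[x]] contains the abelian [K], hence is normal. Its own
    centraliser meets [K] in a nontrivial normal subgroup, which is [K] by minimality. So all
    classes in [K^#] have the same length, the index of ['C_G(K)]. *)
Lemma card_abelian_minimal_der (gT : finGroupType) (G : {group gT}) :
    abelian G^`(1)%g -> minnormal G^`(1)%g G ->
  (#|G : 'C_G(G^`(1)%g)| %| #|G^`(1)%g|.-1)%N.
Proof.
set K := G^`(1)%G => cKK /mingroupP[/andP[ntK nKG] minK].
have sKG: K \subset G by apply: der_sub.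
have cent_elt x : x \in K -> x != 1%g -> 'C_G[x] = 'C_G(K).
  move=> Kx ntx; apply/eqP; rewrite eqEsubset andbC setIS /=; last first.
    by rewrite -cent_set1 centS ?sub1set.
  have nsCG: 'C_G[x] <| G.
    rewrite sub_der1_normal ?subsetIl // subsetI sKG sub_cent1.
    exact: subsetP cKK x Kx.
  rewrite subsetI subsetIl centsC; apply/setIidPl/minK; rewrite ?subsetIl //.
  apply/andP; split; last by rewrite normsI // norms_cent // normal_norm.
  by apply/trivgPn; exists x => //; rewrite inE Kx -sub_cent1 subsetIr.
rewrite (cardsD1 1%g K) group1 /=.
have actG: [acts G, on K^# | 'J] by rewrite astabsJ normD1.
rewrite -(acts_sum_card_orbit actG); apply: dvdn_sum => _ /imsetP[x /setD1P[ntx Kx] ->].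
by rewrite card_orbit astab1J cent_elt.
Qed.

(** The orbit length [t] divides [#|K| - 1], hence is prime to [q]. A zero of ['chi_i] at the
    [q]-element [g] would be a zero of the orbit sum, a character of degree [t], and [q] would
    divide [t]. *)
Lemma abelian_minimal_der_nonvanishing (gT : finGroupType) (G : {group gT}) i g :
    abelian G^`(1)%g -> minnormal G^`(1)%g G -> 'chi[G]_i \in 'CF(G, G^`(1)%g) ->
  g \in G^`(1)%g -> 'chi_i g != 0.
Proof.
set K := G^`(1)%G => cKK minK onK Kg; apply/eqP=> chig0.
have nsKG: K <| G by apply: der_normal.
have sKG := normal_sub nsKG.
have [_ ntK /is_abelemP[q q_pr abelK]] := minnormal_solvable minK (subxx K) (abelian_sol cKK).
have qK := abelem_pgroup abelK; have [_ qdvK _] := pgroup_pdiv qK ntK.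
have [j constt_j] : {j | j \in irr_constt ('Res[K] 'chi_i)}.
  by apply: constt_cfRes_irr.
have [u [eq_u resE _]] := Clifford_index_support nsKG onK constt_j.
set t := #|G : _| in eq_u.
have t_dvd: (t %| #|K|.-1)%N.
  apply: dvdn_trans (card_abelian_minimal_der cKK minK).
  by apply: indexgS; apply: cent_sub_Inertia.
have [qt|] := boolP (q %| t)%N.
  have := dvdn_trans qt t_dvd; rewrite -subn1 dvdn_subr ?cardG_gt0 // dvdn1 => /eqP q1.
  by rewrite q1 in q_pr.
case/negP; have Nsum: \sum_(xi <- ('chi_j ^: G)%CF) xi \is a character.
  rewrite big_seq rpred_sum // => _ /cfclassP[y _ ->].
  by rewrite cfConjg_char ?irr_char.
have lin_j: 'chi_j \is a linear_char by apply/char_abelianP.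
have u_neq0: (u%:R != 0 :> algC).
  rewrite pnatr_eq0; apply: contra_eq_neq eq_u => ->.
  by rewrite mul0n eq_sym -lt0n indexg_gt0.
have := char_p_elt_mod q_pr Nsum Kg (mem_p_elt qK Kg).
have -> : (\sum_(xi <- ('chi_j ^: G)%CF) xi) 1%g = t%:R.
  rewrite sum_cfunE big_seq (eq_bigr (fun=> 1)) => [|_ /cfclassP[y _ ->]]; last first.
    by rewrite cfConjg1 lin_char1.
  by rewrite -big_seq big_const_seq count_predT iter_addr_0 size_cfclass.
rewrite dvdC_nat; apply; apply: (mulfI u_neq0); rewrite mulr0.
have := cfResE 'chi_i sKG Kg; rewrite resE cfunE chig0; exact.
Qed.

(** Besides ['chi_j 1], the factors of ['chi_i 1] in Clifford's formula divide [#|G : N|]. *)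
Lemma degree_coprime_index (gT : finGroupType) (G N : {group gT}) p i j :
    N <| G -> 'chi[G]_i \in 'CF(G, N) -> j \in irr_constt ('Res[N] 'chi_i) ->
    prime p -> ~~ (p %| #|G : N|)%N -> ~~ (p %| 'chi_j 1%g)%C ->
  ~~ (p %| 'chi_i 1%g)%C.
Proof.
move=> nsNG onN constt_j p_pr p'GN p'j.
have [u [eq_u _ ->]] := Clifford_index_support nsNG onN constt_j.
rewrite -eq_u Euclid_dvdM // Euclid_dvdX // andbT negb_or in p'GN.
rewrite irr1_degree dvdC_nat in p'j; rewrite irr1_degree -natrM dvdC_nat.
by rewrite !Euclid_dvdM // !negb_or p'GN.
Qed.

(* Thompson's degree argument: the [theta(1) ^ 2] of the nontrivial orbits of a
   Sylow p-subgroup on [Irr K] vanish mod p, so if p divides [#|K|], some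
   nontrivial invariant theta has degree prime to p and extends. *)
Lemma perfect_der_prime'_index (gT : finGroupType) (G : {group gT}) p :
    let K := G^`(1)%g in K^`(1)%g = K ->
    (forall i, nonlinear_irr i -> 'chi[G]_i \in 'CF(G, K)) ->
    prime p -> (p %| #|G : K|)%N ->
  ~~ (p %| #|K|)%N.
Proof.
set K := G^`(1)%G => /= perfK onK p_pr p_dv; apply/negP=> pK.
have nsKG: K <| G by apply: der_normal.
have [sKG nKG] := andP nsKG.
have [P sylP] := Sylow_exists p G; have [sPG pP _] := and3P sylP.
have nKP := subset_trans sPG nKG.
have actP: is_action 'N(K) (@conjg_Iirr _ K).
  split=> [y|i y z Ny Nz]; first exact: conjg_Iirr_inj.
  by apply: irr_inj; rewrite !conjg_IirrE cfConjgMnorm.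
pose to := Action actP.
pose d (i : Iirr K) := Num.truncn ('chi_i 1%g).
have dE i : 'chi[K]_i 1%g = (d i)%:R by rewrite /d irr1_degree natrK.
have sum_d : (\sum_i d i ^ 2 = #|K|)%N.
  apply/eqP; rewrite -(eqr_nat algC) natr_sum -irr_sum_square; apply/eqP.
  by apply: eq_bigr => i _; rewrite dE natrX.
case: (pickP [pred i : Iirr K | [&& i != 0, i \in 'Fix_to(P) & ~~ (p %| d i)%N]]) => [i | nofix].
  case/and3P=> nz_i /afixP fix_i p'd_i; pose L := (K <*> P)%G.
  have sKL: K \subset L := joing_subl K P.
  have sPL: P \subset L := joing_subr K P.
  have sLG: L \subset G by rewrite join_subG sKG.
  have nsLG: L <| G by rewrite sub_der1_normal.
  have nsKL: K <| L := normalS sKL sLG nsKG.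
  have p'GL: ~~ (p %| #|G : L|)%N.
    by rewrite -p'natE //; case/and3P: sylP => _ _; apply: pnat_dvd; apply: indexgS.
  have solLK: solvable (L / K).
    by apply: abelian_sol; apply: abelianS (der_abelian 0 G); apply: quotientS.
  have pLK: p.-nat #|L : K|.
    by rewrite -card_quotient ?normal_norm // quotientYidl // [p.-nat _]quotient_pgroup.
  have IL: L \subset 'I['chi_i].
    rewrite join_subG sub_inertia; apply/subsetP=> y Py.
    by rewrite inE (subsetP nKP) //= -conjg_IirrE -[conjg_Iirr i y]/(to i y) fix_i.
  (* A perfect group has only the trivial linear character. With determinantal order 1, the
     extension to [L] only asks that ['chi_i 1] be prime to [p]. *)
  have det1: ('o('chi_i)%CF = 1)%N.
    have lin_det: cfDet 'chi_i \is a linear_char := cfDet_lin_char _.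
    have: (#[cfDet 'chi_i]%CF %| 1)%N.
      rewrite dvdn_cforder expr1; apply/eqP/cfun_inP=> x Kx.
      have kx: x \in cfker (cfDet 'chi_i).
        by apply: (subsetP (lin_char_der1 lin_det)); rewrite /= perfK.
      by rewrite (cfker1 kx) lin_char1 // cfun1E Kx.
    by rewrite dvdn1 => /eqP.
  have coLK: coprime #|L : K| ('o('chi_i)%CF * Num.truncn ('chi_i 1%g)).
    rewrite det1 mul1n; apply: pnat_coprime pLK _.
    by rewrite p'natE // lt0n -(eqr_nat algC) -dE irr1_neq0.
  have [e [res_e _ _]] := extend_solvable_coprime_irr nsKL solLK IL coLK.
  have [k constt_k] := constt_cfInd_irr e sLG.
  rewrite constt_Ind_Res in constt_k.
  have constt_ki: i \in irr_constt ('Res[K] 'chi_k).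
    rewrite -(cfResRes _ sKL sLG); apply: constt_Res_trans constt_k _ _.
      by rewrite cfRes_char ?irr_char.
    by rewrite res_e constt_irr inE.
  have nl_k: nonlinear_irr k.
    rewrite nonlinear_irrE; apply: contra nz_i => lin_k.
    have: 'Res[K] 'chi_k = 'chi_0.
      rewrite irr0; apply/cfun_inP=> x Kx; rewrite cfResE // cfun1E Kx.
      by rewrite cfker1 ?lin_char1 // (subsetP (lin_char_der1 lin_k)).
    by move=> res_k; rewrite res_k constt_irr inE in constt_ki.
  have onKk := onK k nl_k.
  have p'e: ~~ (p %| 'chi_e 1%g)%C by rewrite -(cfRes1 K) res_e dE dvdC_nat.
  (* The degree of ['chi_k] is prime to [p]; yet [p] divides [#|G : K|], so ['chi_k] vanishes at an
     element of [P] outside [K], and [p] divides its degree. *)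
  case/negP: (degree_coprime_index nsLG (cfun_onS sKL onKk) constt_k p_pr p'GL p'e).
  have [u Pu notKu]: exists2 u, u \in P & u \notin K.
    apply/subsetPn; apply: contraL p_dv => sPK; rewrite -p'natE //.
    by case/and3P: sylP => _ _; apply: pnat_dvd; apply: indexgS.
  apply: (char_p_elt_mod p_pr (irr_char k) (subsetP sPG u Pu) (mem_p_elt pP Pu)).
  exact: cfun_on0 onKk notKu.
(* Now only the principal character counts modulo [p], so [#|K|] would be congruent to 1. *)
have := pgroup_sum_fix (to := to) (F := fun i => d i ^ 2)%N pP nKP _.
rewrite sum_d => eq_mod.
have {}eq_mod: (#|K| = \sum_(i in 'Fix_to(P)) d i ^ 2 %[mod p])%N.
  by apply: eq_mod => i y _; rewrite /d /= conjg_IirrE cfConjg1.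
have fix0: (0 : Iirr K) \in 'Fix_to(P) by apply/afixP=> y _; apply: conjg_Iirr0.
have d0: d 0 = 1%N by apply/eqP; rewrite -(eqr_nat algC) -dE irr0 cfun11.
move: eq_mod; rewrite (bigD1 0) //= d0 (eqP pK) -modnDmr.
have /eqP->: (p %| \sum_(i in 'Fix_to(P) | i != 0%R) d i ^ 2)%N.
  apply: dvdn_sum => i /andP[fix_i nz_i]; apply: dvdn_mulr.
  by have /negbT := nofix i; rewrite /= nz_i fix_i negbK.
by rewrite modn_small ?prime_gt1.
Qed.

Lemma order_class (gT : finGroupType) (A : {set gT}) x y : x \in y ^: A -> #[x] = #[y].
Proof. by case/imsetP=> z _ ->; rewrite orderJ. Qed.

(** * Classes of elements of prime order in a normal Hall subgroup *)

Section PrimeOrderClasses.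

Variables (gT : finGroupType) (G K : {group gT}) (p : nat).
Hypothesis nsKG : K <| G.
Hypothesis coKG : coprime #|K| #|G : K|.
Hypothesis conj_coset : forall z x, z \in G -> z \notin K -> x \in K -> (z * x)%g \in z ^: G.
Hypothesis prime_elt : forall x, x \in K^# -> prime #[x].
Hypothesis abelGK : abelian (G / K).
Hypothesis p_pr : prime p.
Hypothesis p_class : {in K &, forall x y, #[x] = p -> #[y] = p -> x \in y ^: G}.

Let sKG := normal_sub nsKG.

Let hallK : \pi(K).-Hall(G) K.
Proof. by apply: Hall_pi; rewrite /Hall sKG. Qed.

(** If [z] centralises [x] and lies outside [K], so does its [p']-part, since the [p]-part is in the
    normal Hall subgroup [K]. This [p']-part is conjugate to its product with [x], whose order is
    [p] times larger. *)
Lemma cent1_prime_sub x : x \in K -> #[x] = p -> 'C_G[x] \subset K.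
Proof.
move=> Kx ox; have Gx := subsetP sKG x Kx.
apply/subsetP=> z /setIP[Gz /cent1P cxz]; apply: contraT => notKz.
have Kzp: z.`_p \in K.
  rewrite (mem_normal_Hall hallK nsKG) ?groupX //.
  apply: sub_p_elt (p_elt_constt p z) => q; rewrite !inE => /eqP->.
  by rewrite mem_primes p_pr cardG_gt0 -ox order_dvdG.
have Gz': z.`_p^' \in G by rewrite groupX.
have notKz': z.`_p^' \notin K by rewrite -(groupMl _ Kzp) consttC.
have czx: commute z.`_p^' x by apply/commute_sym/commuteX.
have co_zx: coprime #[z.`_p^'] #[x].
  rewrite ox coprime_sym prime_coprime // -p'natE //; exact: p_elt_constt.
have := order_class (conj_coset Gz' notKz' Kx).
rewrite orderM // ox => /eqP; rewrite -[X in _ == X]muln1 eqn_pmul2l ?order_gt0 //.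
by move/eqP=> p1; have := p_pr; rewrite p1.
Qed.

Lemma cent1_prime_pgroup x : x \in K -> #[x] = p -> p.-group 'C_G[x].
Proof.
move=> Kx ox; apply/pgroupP=> q q_pr /(Cauchy q_pr)[y Cy oy].
have Ky := subsetP (cent1_prime_sub Kx ox) y Cy.
have /setIP[_ /cent1P cxy] := Cy.
rewrite inE /=; apply: contraT => neq_qp.
have co_xy: coprime #[x] #[y].
  by rewrite ox oy prime_coprime // dvdn_prime2 // eq_sym.
have oxy: #[(x * y)%g] = (p * q)%N by rewrite (orderM _ co_xy) ?ox ?oy //; apply: commute_sym.
have /prime_elt: (x * y)%g \in K^#.
  rewrite !inE groupM // andbT -order_eq1 oxy.
  by rewrite muln_eq1 negb_and (gtn_eqF (prime_gt1 p_pr)).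
rewrite oxy => /primeP[_ /(_ p (dvdn_mulr _ (dvdnn p)))] /orP[/eqP p1 | ].
  by have := p_pr; rewrite p1.
rewrite -[X in X == _]muln1 eqn_pmul2l ?prime_gt0 // => /eqP q1.
by rewrite -q1 in q_pr.
Qed.

(** The centraliser is a [p]-subgroup of [K]. Conversely, [x] is conjugate to a central element of a
    Sylow [p]-subgroup [S], so its order is at least that of [S]. *)
Lemma card_cent1_prime x : x \in K -> #[x] = p -> #|'C_G[x]| = (#|K|`_p)%N.
Proof.
move=> Kx ox; have Gx := subsetP sKG x Kx.
have pC := cent1_prime_pgroup Kx ox; have sCK := cent1_prime_sub Kx ox.
apply/eqP; rewrite eqn_dvd; apply/andP; split.
  by rewrite -(part_pnat_id pC) partn_dvd ?cardSg ?cardG_gt0.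
have [S sylS] := Sylow_exists p K; have [sSK pS _] := and3P sylS.
have ntS: S :!=: 1%g.
  by rewrite -rank_gt0 (rank_Sylow sylS) p_rank_gt0 mem_primes p_pr cardG_gt0 -ox order_dvdG.
have ntZ: 'Z(S) != 1%g by rewrite center_nil_eq1 // (pgroup_nil pS).
have [_ pdvZ _] := pgroup_pdiv (pgroupS (center_sub S) pS) ntZ.
have [z Zz oz] := Cauchy p_pr pdvZ.
have /setIP[Sz cSz] := Zz; have Kz := subsetP sSK z Sz.
rewrite -(card_Hall sylS); have /imsetP[g Gg Dz] := p_class Kz Kx oz ox.
have -> : #|'C_G[x]| = #|'C_G[z]|.
  by rewrite Dz -conjg_set1 normJ -{2}(conjGid Gg) -conjIg cardJg.
apply: cardSg; rewrite subsetI (subset_trans sSK sKG) sub_cent1.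
by [].
Qed.

(** A Schur-Zassenhaus complement [H] of [K] normalises some Sylow [p]-subgroup [S] of [K].
    Centralisers of elements of order [p] lie in [K], so [H] acts semiregularly on [S^#]. *)
Lemma index_dvd_cent1_prime x : x \in K -> #[x] = p -> (#|G : K| %| #|'C_G[x]|.-1)%N.
Proof.
move=> Kx ox.
have /splitsP[H /complP[tiKH defG]] : [splits G, over K].
  by apply: SchurZassenhaus_split; rewrite // /Hall sKG.
have oH: #|H| = #|G : K|.
  apply/eqP; rewrite -(eqn_pmul2l (cardG_gt0 K)) Lagrange // -defG.
  by rewrite TI_cardMg.
have sHG: H \subset G by rewrite -defG mulG_subr.
have nKH := subset_trans sHG (normal_norm nsKG).
have solH: solvable H.
  apply: abelian_sol; have /isog_abelian-> : H \isog H / K.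
    by rewrite quotient_isog // setIC.
  exact: abelianS (quotientS K sHG) abelGK.
have coKH: coprime #|K| #|H| by rewrite oH.
have [S sylS nSH] := sol_coprime_Sylow_exists p solH nKH coKH.
have [sSK pS _] := and3P sylS.
rewrite (card_cent1_prime Kx ox) -(card_Hall sylS) -oH.
apply: regular_norm_dvd_pred nSH _ => h /setD1P[nth Hh].
apply/trivgP/subsetP=> y /setIP[Sy cyh]; rewrite inE; apply: contraT => nty.
have Ky := subsetP sSK y Sy.
have oy: #[y] = p.
  have /prime_elt y_pr: y \in K^# by rewrite !inE nty.
  by have := mem_p_elt pS Sy; rewrite /p_elt pnatE // => /eqP.
case/negP: nth; rewrite -in_set1 -[[set 1%g]]tiKH inE Hh andbT.
apply: (subsetP (cent1_prime_sub Ky oy) h).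
by rewrite inE (subsetP sHG) //= cent1C.
Qed.

End PrimeOrderClasses.

(** The character is constant on [<[x]>^#], so the multiplicity of the principal character in its
    restriction to [<[x]>] expresses ['chi_i x] rationally. A rational algebraic integer is an
    integer. *)
Lemma int_char_prime_order (gT : finGroupType) (G : {group gT}) (i : Iirr G) x :
    x \in G -> prime #[x] -> (forall y, y \in <[x]>^# -> y \in x ^: G) ->
  'chi_i x \in Num.int.
Proof.
move=> Gx x_pr conj_x; apply: Cint_rat_Aint; last exact: Aint_irr.
have sxG: <[x]> \subset G by rewrite cycle_subG.
have /natrP[n Dn]: '['Res[<[x]>] 'chi_i, 'chi_0] \in Num.nat.
  by rewrite Cnat_cfdot_char_irr ?cfRes_char ?irr_char.
have px: (#[x].-1%:R != 0 :> algC) by rewrite pnatr_eq0 -lt0n -subn1 subn_gt0 prime_gt1.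
have -> : 'chi_i x = (#[x]%:R * n%:R - 'chi_i 1%g) / #[x].-1%:R.
  apply: (canRL (mulfK px)); apply: (canRL (addrK _)).
  rewrite -Dn irr0 cfdotE mulVKf ?neq0CG // (bigD1 1%g) ?group1 //=.
  rewrite cfResE ?group1 // cfun11 conjC1 mulr1 addrC; congr (_ + _).
  rewrite (eq_bigr (fun=> 'chi_i x)) => [|y /andP[xy nty]]; last first.
    rewrite cfResE // cfun1E xy conjC1 mulr1.
    have /conj_x/imsetP[g Gg ->] : y \in <[x]>^# by rewrite !inE nty.
    by rewrite cfunJ.
  rewrite (eq_bigl (fun y => y \in <[x]>^#)) => [|y]; last by rewrite !inE andbC.
  have -> : #[x] = #|<[x]>^#|.+1 by rewrite /order (cardsD1 1%g) group1.
  by rewrite sumr_const mulr_natr.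
by rewrite irr1_degree rpred_div ?rpredB ?rpredM ?rpred_nat.
Qed.

(** * Groups with three nonlinear irreducible characters *)

Section ThreeNonlinearCharacters.

Variables (gT : finGroupType) (G : {group gT}) (c l1 l2 : Iirr G).
Let K := G^`(1)%G.
Let m := #|G : K|.

Hypothesis nonlin3 : forall i : Iirr G, nonlinear_irr i = (i \in [:: c; l1; l2]).
Hypothesis uniq3 : uniq [:: c; l1; l2].
Hypothesis nonlin_real : forall i x, nonlinear_irr i -> ('chi[G]_i x)^* = 'chi_i x.
Hypothesis nonlin_off_der : forall i x, nonlinear_irr i -> x \in G -> x \notin K -> 'chi[G]_i x = 0.

Lemma sum_irr_split (F : Iirr G -> algC) :
  \sum_i F i = \sum_(i | 'chi_i \is a linear_char) F i + (F c + F l1 + F l2).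
Proof.
rewrite (bigID (fun i => 'chi_i \is a linear_char)) /=; congr (_ + _).
rewrite (eq_bigl (fun i => i \in [:: c; l1; l2])) => [|i]; last first.
  by rewrite -nonlin3 nonlinear_irrE.
by rewrite -big_uniq //= !big_cons big_nil addr0 addrA.
Qed.

Lemma sum_linear_irr (F : Iirr G -> algC) :
    (forall i, 'chi_i \is a linear_char -> F i = 1) ->
  \sum_(i | 'chi[G]_i \is a linear_char) F i = m%:R.
Proof.
by move=> F1; rewrite (eq_bigr (fun=> 1)) // sumr_const -[m](card_lin_irr G).
Qed.

Let sKG : K \subset G := der_sub 1 G.
Let nsKG : K <| G := der_normal 1 G.

Lemma linear_irr_der i x : 'chi[G]_i \is a linear_char -> x \in K -> 'chi_i x = 1.
Proof.
move=> lin_i Kx; have kx: x \in cfker 'chi_i by apply: subsetP Kx; exact: lin_char_der1.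
by rewrite cfker1 ?lin_char1.
Qed.

Let nlc : nonlinear_irr c. Proof. by rewrite nonlin3 !inE eqxx. Qed.
Let nl1 : nonlinear_irr l1. Proof. by rewrite nonlin3 !inE eqxx orbT. Qed.
Let nl2 : nonlinear_irr l2. Proof. by rewrite nonlin3 !inE eqxx !orbT. Qed.

Lemma column_orthogonality x y : x \in K -> y \in K ->
  m%:R + ('chi_c x * 'chi_c y + 'chi_l1 x * 'chi_l1 y + 'chi_l2 x * 'chi_l2 y)
    = #|'C_G[x]|%:R *+ (x \in y ^: G).
Proof.
move=> Kx Ky; rewrite -second_orthogonality_relation ?(subsetP sKG) //.
rewrite sum_irr_split !nonlin_real // sum_linear_irr // => i lin_i.
by rewrite !linear_irr_der // conjC1 mulr1.
Qed.

Lemma quotient_column (N : {group gT}) x : N <| G -> N \subset K -> x \in K -> x \notin N ->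
  let F i := if N \subset cfker 'chi[G]_i then 'chi_i 1%g * 'chi_i x else 0 in
  m%:R + (F c + F l1 + F l2) = 0.
Proof.
move=> nsNG sNK Kx notNx F.
rewrite -(quotient_regular_eq0 nsNG (subsetP sKG _ Kx) notNx) big_mkcond /=.
rewrite sum_irr_split sum_linear_irr // => i lin_i.
by rewrite (subset_trans sNK (lin_char_der1 lin_i)) !linear_irr_der // mulr1.
Qed.

(** No irreducible character separates the two elements: nonlinear ones vanish at both, linear ones
    are trivial on [K]. *)
Lemma conj_coset_der z x : z \in G -> z \notin K -> x \in K -> (z * x)%g \in z ^: G.
Proof.
move=> Gz notKz Kx; have Gx := subsetP sKG x Kx.
have notKzx: (z * x)%g \notin K by rewrite groupMr.
apply: irr_eq_conjugate => [||i]; rewrite ?groupM //.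
have [nl_i|] := boolP (nonlinear_irr i); first by rewrite !nonlin_off_der // groupM.
by rewrite nonlinear_irrE negbK => lin_i; rewrite lin_charM // (linear_irr_der lin_i Kx) mulr1.
Qed.

(* [c] is the centre of the star, [l1] and [l2] its leaves, and [g1], [g2] witness
   the adjacency of [c] with [l1] and [l2]. *)
Variables g1 g2 : gT.
Hypotheses (Gg1 : g1 \in G) (Gg2 : g2 \in G).
Hypotheses (cg1 : 'chi_c g1 != 0) (l1g1 : 'chi_l1 g1 != 0) (l2g1 : 'chi_l2 g1 = 0).
Hypotheses (cg2 : 'chi_c g2 != 0) (l2g2 : 'chi_l2 g2 != 0) (l1g2 : 'chi_l1 g2 = 0).
Hypothesis leaves : forall x, x \in vanG G -> 'chi_l1 x * 'chi_l2 x = 0.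

Let Kg1 : g1 \in K.
Proof. by apply: contraR cg1 => /(nonlin_off_der nlc Gg1)->. Qed.
Let Kg2 : g2 \in K.
Proof. by apply: contraR cg2 => /(nonlin_off_der nlc Gg2)->. Qed.

Lemma column_not_conj x y : x \in K -> y \in K -> x \notin y ^: G ->
  m%:R + ('chi_c x * 'chi_c y + 'chi_l1 x * 'chi_l1 y + 'chi_l2 x * 'chi_l2 y) = 0.
Proof. by move=> Kx Ky /negPf notxyG; rewrite column_orthogonality // notxyG mulr0n. Qed.

Lemma irr_class i x y : x \in y ^: G -> 'chi[G]_i x = 'chi_i y.
Proof. by case/imsetP=> z Gz ->; rewrite cfunJ. Qed.

Lemma centre_g1_g2 : m%:R + 'chi_c g1 * 'chi_c g2 = 0.
Proof.
have notg12: g1 \notin g2 ^: G.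
  by apply: contra_neqN l1g1 => /(irr_class l1) ->.
by have := column_not_conj Kg1 Kg2 notg12; rewrite l2g1 l1g2 mulr0 mul0r !addr0.
Qed.

Let m_gt0 : (0 < m)%N := indexg_gt0 G K.

Lemma g1_col x : x \in K -> x \notin g1 ^: G ->
  m%:R + ('chi_c x * 'chi_c g1 + 'chi_l1 x * 'chi_l1 g1) = 0.
Proof. by move=> Kx ng1; have := column_not_conj Kx Kg1 ng1; rewrite l2g1 mulr0 addr0. Qed.

Lemma g2_col x : x \in K -> x \notin g2 ^: G ->
  m%:R + ('chi_c x * 'chi_c g2 + 'chi_l2 x * 'chi_l2 g2) = 0.
Proof. by move=> Kx ng2; have := column_not_conj Kx Kg2 ng2; rewrite l1g2 mulr0 addr0. Qed.

Let irr1_gt0 i : 0 < 'chi[G]_i 1%g := irr1_gt0 i.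

Let mC_neq0 : m%:R != 0 :> algC.
Proof. by rewrite pnatr_eq0 -lt0n. Qed.

Let ntg1 : g1 != 1%g.
Proof. by apply: contra_eq_neq l2g1 => ->; rewrite irr1_neq0. Qed.
Let ntg2 : g2 != 1%g.
Proof. by apply: contra_eq_neq l1g2 => ->; rewrite irr1_neq0. Qed.

(** If [K = G], Burnside's zero [h] of ['chi_c] lies in [K], and its columns against [g1] and [g2]
    make both leaves nonzero at [h], contrary to [leaves]. *)
Lemma index_der_gt1 : (1 < m)%N.
Proof.
rewrite ltn_neqAle eq_sym m_gt0 andbT; apply/eqP=> m1.
have KG : K :=: G by apply/eqP; rewrite eqEsubset sKG -indexg_eq1 -/m m1.
have [h Gh ch] := nonlinear_irr_vanish nlc.
have Kh: h \in K by rewrite KG.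
have nhg1: h \notin g1 ^: G by apply: contra_neqN cg1 => /(irr_class c) <-.
have nhg2: h \notin g2 ^: G by apply: contra_neqN cg2 => /(irr_class c) <-.
have := g1_col Kh nhg1; have := g2_col Kh nhg2; rewrite ch !mul0r !add0r => e2 e1.
have /leaves/eqP: h \in vanG G by apply/bigcupP; exists c; rewrite // inE Gh ch eqxx.
rewrite mulf_eq0 => /orP[] /eqP h0; [move: e1 | move: e2].
  by rewrite h0 mul0r addr0 => /eqP; rewrite (negPf mC_neq0).
by rewrite h0 mul0r addr0 => /eqP; rewrite (negPf mC_neq0).
Qed.


Let not1_class x : x != 1%g -> 1%g \notin x ^: G.
Proof. by move=> nt_x; rewrite class_sym class1G inE. Qed.

Lemma column1 x : x \in K -> x != 1%g ->
  m%:R + ('chi_c 1%g * 'chi_c x + 'chi_l1 1%g * 'chi_l1 x + 'chi_l2 1%g * 'chi_l2 x) = 0.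
Proof. by move=> Kx nt_x; rewrite column_not_conj // not1_class. Qed.

Lemma der_minimal (N : {group gT}) :
  N <| G -> N \subset K -> N :!=: 1%g -> N :=: K.
Proof.
move=> nsNG sNK ntN; apply/eqP; rewrite eqEsubset sNK.
apply/subsetP=> x Kx; apply: contraT => notNx.
have ker_val (i : Iirr G) y : N \subset cfker 'chi_i -> y \in N -> 'chi_i y = 'chi_i 1%g.
  by move=> /subsetP kN Ny; rewrite cfker1 ?kN.
(* Compare the relations between [g1] and 1 in [G] and in [G / N]: [m] and both character terms are
   nonzero, so neither term can be missing from the second. *)
have kN1: g1 \notin N -> (N \subset cfker 'chi_c) && (N \subset cfker 'chi_l1).
  move=> ng1; have := quotient_column nsNG sNK Kg1 ng1.
  have := column1 Kg1 ntg1; rewrite /= l2g1 !mulr0 !addr0 if_same addr0.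
  have nzc := mulf_neq0 (lt0r_neq0 (irr1_gt0 c)) cg1.
  have nz1 := mulf_neq0 (lt0r_neq0 (irr1_gt0 l1)) l1g1.
  case: ifP => _; case: ifP => _ // e1 e2; exfalso.
  - by move/eqP: nz1; apply; move: e1; rewrite addr0 in e2; rewrite addrA e2 add0r.
  - by move/eqP: nzc; apply; move: e1; rewrite add0r in e2; rewrite addrCA e2 addr0.
  - by move/eqP: mC_neq0; rewrite -e2 !addr0.
have kN2: g2 \notin N -> (N \subset cfker 'chi_c) && (N \subset cfker 'chi_l2).
  move=> ng2; have := quotient_column nsNG sNK Kg2 ng2.
  have := column1 Kg2 ntg2; rewrite /= l1g2 !mulr0 !addr0 if_same addr0.
  have nzc := mulf_neq0 (lt0r_neq0 (irr1_gt0 c)) cg2.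
  have nz1 := mulf_neq0 (lt0r_neq0 (irr1_gt0 l2)) l2g2.
  case: ifP => _; case: ifP => _ // e1 e2; exfalso.
  - by move/eqP: nz1; apply; move: e1; rewrite addr0 in e2; rewrite addrA e2 add0r.
  - by move/eqP: nzc; apply; move: e1; rewrite add0r in e2; rewrite addrCA e2 addr0.
  - by move/eqP: mC_neq0; rewrite -e2 !addr0.
(* With both witnesses in [N], the relation at [x] puts [N] in the kernel of ['chi_c], against
   [centre_g1_g2]. With just one, a leaf whose kernel contains [N] vanishes at it. With none, [N]
   lies in every kernel. *)
have [Ng1 | ng1] := boolP (g1 \in N); have [Ng2 | ng2] := boolP (g2 \in N).
- have n1: N \subset cfker 'chi_l1 = false.
    by apply/negP=> /ker_val/(_ Ng2)/eqP; rewrite l1g2 eq_sym (negPf (irr1_neq0 _)).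
  have n2: N \subset cfker 'chi_l2 = false.
    by apply/negP=> /ker_val/(_ Ng1)/eqP; rewrite l2g1 eq_sym (negPf (irr1_neq0 _)).
  have := quotient_column nsNG sNK Kx notNx; rewrite /= n1 n2 !addr0.
  case: ifP => [/ker_val kc _ | _ /eqP]; last by rewrite addr0 (negPf mC_neq0).
  have /eqP := centre_g1_g2; rewrite !kc // gt_eqF // addr_gt0 ?mulr_gt0 ?ltr0n //.
- have /andP[_ /ker_val/(_ Ng1)/eqP] := kN2 ng2.
  by rewrite l2g1 eq_sym (negPf (irr1_neq0 _)).
- have /andP[_ /ker_val/(_ Ng2)/eqP] := kN1 ng1.
  by rewrite l1g2 eq_sym (negPf (irr1_neq0 _)).
case/negP: ntN; rewrite -subG1 -(TI_cfker_irr G); apply/bigcapsP=> i _.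
have [/[!nonlin3] | ] := boolP (nonlinear_irr i).
  have [/andP[kc k1] /andP[_ k2]] := (kN1 ng1, kN2 ng2).
  by rewrite !inE; case/or3P=> /eqP->.
rewrite nonlinear_irrE negbK => /lin_char_der1; exact: subset_trans.
Qed.

(** Off the classes of [g1] and [g2], a zero of ['chi_c] forces both leaves to be nonzero. If
    instead both leaves vanish, the columns give ['chi_c g1 = 'chi_c g2], a real number whose square
    would be [- m]. *)
Lemma two_nonzero x : x \in K ->
  [|| ('chi_c x != 0) && ('chi_l1 x != 0), ('chi_c x != 0) && ('chi_l2 x != 0)
    | ('chi_l1 x != 0) && ('chi_l2 x != 0)].
Proof.
move=> Kx; have [xg1 | nxg1] := boolP (x \in g1 ^: G).
  by rewrite !(irr_class _ xg1) cg1 l1g1.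
have [xg2 | nxg2] := boolP (x \in g2 ^: G).
  by rewrite !(irr_class _ xg2) cg2 l2g2 orbT.
have := g1_col Kx nxg1; have := g2_col Kx nxg2.
have [-> | nzc] := eqVneq ('chi_c x) 0.
  rewrite !mul0r !add0r /= => e2 e1; apply/andP; split.
    by apply: contra_eq_neq e1 => ->; rewrite mul0r addr0.
  by apply: contra_eq_neq e2 => ->; rewrite mul0r addr0.
have [-> | nz1] := eqVneq ('chi_l1 x) 0 => //.
have [-> | nz2] := eqVneq ('chi_l2 x) 0; rewrite ?orbT // !mul0r !addr0 => e2 e1.
have eg: 'chi_c g1 = 'chi_c g2.
  by apply: (mulfI nzc); apply: (addrI m%:R); rewrite e1 e2.
have /eqP := centre_g1_g2; rewrite -eg -{2}nonlin_real // gt_eqF //.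
by rewrite ltr_wpDr ?mul_conjC_ge0 ?ltr0n.
Qed.

Lemma sum_norm_der i : nonlinear_irr i -> \sum_(x in K) 'chi[G]_i x * 'chi_i x = #|G|%:R.
Proof.
move=> nl_i; have onK: 'chi_i \in 'CF(G, K).
  apply/cfun_onP=> x notKx; have [Gx | /cfun0->//] := boolP (x \in G).
  exact: nonlin_off_der.
have := cfnorm_irr i; rewrite (cfdotEl _ onK) => /(canRL (mulVKf (neq0CG G))).
by rewrite mulr1 => <-; apply: eq_bigr => x _; rewrite nonlin_real.
Qed.

(* Divided by [#|G|]: the subgroup [K] is the union of four classes of [G]. *)
Lemma sum_cent_der : (\sum_(x in K) #|'C_G[x]| = 4 * #|G|)%N.
Proof.
apply/eqP; rewrite -(eqr_nat algC) natr_sum; apply/eqP.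
transitivity (\sum_(x in K) (m%:R +
    ('chi_c x * 'chi_c x + 'chi_l1 x * 'chi_l1 x + 'chi_l2 x * 'chi_l2 x))).
  by apply: eq_bigr => x Kx; rewrite column_orthogonality // class_refl mulr1n.
rewrite !big_split /= !sum_norm_der // sumr_const -mulrnA mulnC Lagrange //.
have ->: (4 * #|G| = #|G| + (#|G| + #|G| + #|G|))%N.
  by rewrite !mulSn mul0n addn0 !addnA.
by rewrite !natrD.
Qed.

Lemma sum_cent_class x : x \in G -> (\sum_(y in x ^: G) #|'C_G[y]| = #|G|)%N.
Proof.
move=> Gx; rewrite (eq_bigr (fun=> #|'C_G[x]|)) => [|y /imsetP[z Gz ->]].
  by rewrite sum_nat_const -index_cent1 mulnC Lagrange ?subsetIl.
by rewrite -conjg_set1 normJ -{1}(conjGid Gz) -conjIg cardJg.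
Qed.

(** Together with the class of 1, these classes already exhaust the sum in [sum_cent_der], each
    contributing [#|G|]. *)
Lemma three_classes x y z : x \in K^# -> y \in K^# -> z \in K^# ->
    x \notin y ^: G -> x \notin z ^: G -> y \notin z ^: G ->
  [/\ forall w, w \in K^# -> [|| w \in x ^: G, w \in y ^: G | w \in z ^: G]
    & (#|K| = 1 + #|x ^: G| + #|y ^: G| + #|z ^: G|)%N].
Proof.
move=> /setD1P[ntx Kx] /setD1P[nty Ky] /setD1P[ntz Kz] nxy nxz nyz.
have Gof w : w \in K -> w \in G by apply: subsetP.
have n1 w : w != 1%g -> w \notin 1%g ^: G by rewrite class1G inE.
have dis u v : u \notin v ^: G -> [disjoint u ^: G & v ^: G].
  move=> nuv; apply/pred0P=> w /=; apply/negP=> /andP[wu wv].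
  by case/negP: nuv; rewrite -(class_eqP wv) class_sym.
have sumU2 (A B : {set gT}) (F : gT -> nat) : [disjoint A & B] ->
    (\sum_(w in A :|: B) F w = \sum_(w in A) F w + \sum_(w in B) F w)%N.
  by move=> disAB; rewrite -bigU //; apply: eq_bigl => w; rewrite !inE.
pose U := 1%g ^: G :|: x ^: G :|: y ^: G :|: z ^: G.
have sumU (F : gT -> nat) : (\sum_(w in U) F w = \sum_(w in 1%g ^: G) F w
     + \sum_(w in x ^: G) F w + \sum_(w in y ^: G) F w + \sum_(w in z ^: G) F w)%N.
  have disU (A B C : {set gT}) : [disjoint A & C] -> [disjoint B & C] -> [disjoint A :|: B & C].
    by move=> disA disB; rewrite -setI_eq0 setIUl setU_eq0 !setI_eq0 disA.
  have dis1 w : w != 1%g -> [disjoint 1%g ^: G & w ^: G].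
    by move=> ntw; rewrite disjoint_sym dis ?n1.
  have dis1x := dis1 x ntx; have dis1y := dis1 y nty; have dis1z := dis1 z ntz.
  rewrite sumU2; last by apply: (disU); [apply: (disU) => // | ]; apply: (dis).
  rewrite sumU2; last by apply: (disU) => //; apply: (dis).
  by rewrite sumU2.
have sUK: U \subset K.
  by rewrite !subUset !class_sub_norm ?(normal_norm nsKG) // group1 Kx Ky.
have eqUK: U = K.
  apply/eqP; rewrite eqEsubset sUK; apply: contraT => nsKU.
  have := sum_cent_der; rewrite (big_setID U) /= (setIidPr sUK) sumU.
  rewrite !sum_cent_class ?Gof //; case/subsetPn: nsKU => w Kw nUw.
  rewrite (bigD1 w) /=; last by rewrite inE nUw.
  move: (\sum_(i in _ | _) _)%N #|'C_G[w]| #|G| (cardG_gt0 'C_G[w]); clear; lia.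
split=> [w|].
  by rewrite -eqUK !inE class1G inE => /andP[/negPf-> /=]; rewrite -orbA.
by rewrite -eqUK -sum1_card sumU !sum1_card class1G cards1.
Qed.

(** By column orthogonality, [#|'C_G[x]|] is [m] plus three squares of integers, at least two of
    them nonzero. *)
Lemma cent1_gt x : x \in K -> prime #[x] ->
    (forall y, y \in <[x]>^# -> y \in x ^: G) ->
  (m.+1 < #|'C_G[x]|)%N.
Proof.
move=> Kx x_pr conj_x; have Gx := subsetP sKG x Kx.
have Zx (i : Iirr G) := int_char_prime_order i Gx x_pr conj_x.
have sqr_ge0 (i : Iirr G) : 0 <= 'chi_i x * 'chi_i x.
  by rewrite -expr2 real_exprn_even_ge0 ?Rreal_int.
have sqr_ge1 (i : Iirr G) : 'chi_i x != 0 -> 1 <= 'chi_i x * 'chi_i x.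
  by move=> nz; rewrite -expr2 sqr_intr_ge1.
rewrite -(ltr_nat algC); have := column_orthogonality Kx Kx.
rewrite class_refl mulr1n => <-; rewrite -addn1 natrD ltrD2l.
have lt12: 1 < 1 + 1 :> algC by rewrite ltrDl ltr01.
apply: lt_le_trans lt12 _; case/or3P: (two_nonzero Kx) => /andP[/sqr_ge1 ge1 /sqr_ge1 ge2].
- by rewrite -[X in X <= _]addr0 !lerD.
- by rewrite -[X in X <= _]addr0 addrAC !lerD.
- by rewrite -[X in X <= _]add0r -addrA !lerD.
Qed.

Lemma three_nonlinear_irr_False : False.
Proof.
have m_gt1 := index_der_gt1.
have ntK: K :!=: 1%g by apply/trivgPn; exists g1; rewrite ?ntg1 ?Kg1.
have minK: minnormal K G.
  apply/mingroupP; split=> [|N /andP[ntN nNG] sNK]; first by rewrite ntK normal_norm.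
  by apply: der_minimal => //; rewrite /normal (subset_trans sNK).
have onK i : nonlinear_irr i -> 'chi[G]_i \in 'CF(G, K).
  move=> nl_i; apply/cfun_onP=> x notKx; have [Gx | /cfun0->//] := boolP (x \in G).
  exact: nonlin_off_der.
have [cKK | nabK] := boolP (abelian K).
  by have := abelian_minimal_der_nonvanishing cKK minK (onK l1 nl1) Kg2; rewrite l1g2 eqxx.
have perfK: K^`(1)%g = K.
  apply: (@der_minimal K^`(1)%G); rewrite ?gFnormal_trans ?der_sub //.
  by apply: contra nabK => /eqP/derG1P.
have coKm: coprime #|K| m.
  rewrite /coprime; apply: contraT => gcd_neq1.
  have p_pr: prime (pdiv (gcdn #|K| m)).
    by rewrite pdiv_prime // ltn_neqAle eq_sym gcd_neq1 gcdn_gt0 cardG_gt0.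
  have := pdiv_dvd (gcdn #|K| m); rewrite dvdn_gcd => /andP[pK pm].
  by case/negP: (perfect_der_prime'_index perfK onK p_pr pm).
have nsolK: ~~ solvable K.
  apply/negP=> /sol_der1_proper/(_ (subxx _) ntK).
  by rewrite /= perfK properxx.
have := contra (@Burnside_p_a_q_b _ K) nsolK; rewrite -ltnNge.
have := primes_uniq #|K|; have mem_pr r := mem_primes r #|K|.
case defpi: (primes #|K|) => [|p [|q [|r s]]] //= uniq_pi _.
have [] : [/\ p \in primes #|K|, q \in primes #|K| & r \in primes #|K|].
  by rewrite defpi !inE !eqxx !orbT.
rewrite !mem_pr => /and3P[p_pr _ pK] /and3P[q_pr _ qK] /and3P[r_pr _ rK].
have [x Kx ox] := Cauchy p_pr pK; have [y Ky oy] := Cauchy q_pr qK.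
have [z Kz oz] := Cauchy r_pr rK.
have npq: p != q by apply: contraNneq (andP uniq_pi).1 => ->; rewrite !inE eqxx.
have npr: p != r by apply: contraNneq (andP uniq_pi).1 => ->; rewrite !inE eqxx !orbT.
have nqr: q != r by case/and3P: uniq_pi => _ + _; apply: contraNneq => ->; rewrite !inE eqxx.
have nt_of w t : prime t -> #[w] = t -> w \in K -> w \in K^#.
  by move=> t_pr ow Kw; rewrite !inE Kw andbT -order_eq1 ow gtn_eqF ?prime_gt1.
have notconj u v t t' : #[u] = t -> #[v] = t' -> t != t' -> u \notin v ^: G.
  by move=> <- <-; apply: contra => /order_class->.
have [cover_K card_K] := three_classes (nt_of x p p_pr ox Kx) (nt_of y q q_pr oy Ky)
  (nt_of z r r_pr oz Kz) (notconj _ _ _ _ ox oy npq) (notconj _ _ _ _ ox oz npr)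
  (notconj _ _ _ _ oy oz nqr).
have order_K w : w \in K^# -> [|| #[w] == p, #[w] == q | #[w] == r].
  by case/cover_K/or3P=> /order_class->; rewrite ?ox ?oy ?oz eqxx ?orbT.
have prime_K w : w \in K^# -> prime #[w].
  by case/order_K/or3P=> /eqP->.
have class_x : {in K &, forall u v, #[u] = p -> #[v] = p -> u \in v ^: G}.
  have class1 u : u \in K -> #[u] = p -> u \in x ^: G.
    move=> Ku ou; case/or3P: (cover_K _ (nt_of u p p_pr ou Ku)) => // /order_class.
      by rewrite ou oy => /eqP; rewrite (negPf npq).
    by rewrite ou oz => /eqP; rewrite (negPf npr).
  by move=> u v Ku Kv /(class1 u Ku) xu /(class1 v Kv) /class_eqP ->.
have class_y : {in K &, forall u v, #[u] = q -> #[v] = q -> u \in v ^: G}.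
  have class1 u : u \in K -> #[u] = q -> u \in y ^: G.
    move=> Ku ou; case/or3P: (cover_K _ (nt_of u q q_pr ou Ku)) => // /order_class.
      by rewrite ou ox => /esym/eqP; rewrite (negPf npq).
    by rewrite ou oz => /eqP; rewrite (negPf nqr).
  by move=> u v Ku Kv /(class1 u Ku) xu /(class1 v Kv) /class_eqP ->.
have class_z : {in K &, forall u v, #[u] = r -> #[v] = r -> u \in v ^: G}.
  have class1 u : u \in K -> #[u] = r -> u \in z ^: G.
    move=> Ku ou; case/or3P: (cover_K _ (nt_of u r r_pr ou Ku)) => // /order_class.
      by rewrite ou ox => /esym/eqP; rewrite (negPf npr).
    by rewrite ou oy => /esym/eqP; rewrite (negPf nqr).
  by move=> u v Ku Kv /(class1 u Ku) xu /(class1 v Kv) /class_eqP ->.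
have centP w t : prime t -> w \in K -> #[w] = t ->
    {in K &, forall u v, #[u] = t -> #[v] = t -> u \in v ^: G} ->
  #|'C_G[w]| = (#|K|`_t)%N /\ exists2 u, (1 < u)%N & #|'C_G[w]| = (1 + m * u)%N.
  move=> t_pr Kw ow class_w.
  split; first exact: (card_cent1_prime nsKG coKm conj_coset_der prime_K t_pr class_w).
  have: (m %| #|'C_G[w]|.-1)%N.
    exact: (index_dvd_cent1_prime nsKG coKm conj_coset_der prime_K (der_abelian 0 G) t_pr class_w).
  case/dvdnP=> u Du; exists u; last by rewrite mulnC -Du add1n prednK ?cardG_gt0.
  (* This bound rules out [u = 0] and [u = 1]. *)
  have: (m.+1 < #|'C_G[w]|)%N.
    apply: cent1_gt; rewrite ?ow // => v /setD1P[ntv wv].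
    have Kv: v \in K by apply: subsetP wv; rewrite cycle_subG.
    apply: class_w => //; apply/eqP; have := order_dvdG wv; rewrite -orderE ow.
    by rewrite dvdn_prime2 // prime_K // !inE ntv.
  rewrite -(prednK (cardG_gt0 'C_G[w])) Du.
  by move: (m) (u) => a [|[|b]]; clear; lia.
have [oCx [u u_gt1 Du]] := centP x p p_pr Kx ox class_x.
have [oCy [v v_gt1 Dv]] := centP y q q_pr Ky oy class_y.
have [oCz [w w_gt1 Dw]] := centP z r r_pr Kz oz class_z.
(* A fourth prime would be the order of an element of [K], against [order_K]. *)
have s0 : s = [::].
  case: s => // t s in defpi uniq_pi *.
  have /[!mem_pr]/and3P[t_pr _ tK]: t \in primes #|K| by rewrite defpi !inE eqxx !orbT.
  have [a Ka oa] := Cauchy t_pr tK; move: uniq_pi; rewrite !inE.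
  case/or3P: (order_K a (nt_of a t t_pr oa Ka)); rewrite oa => /eqP->; rewrite eqxx ?orbT //=.
  - by rewrite andbF.
  by rewrite !andbF.
have cardK: #|K| = (#|'C_G[x]| * #|'C_G[y]| * #|'C_G[z]|)%N.
  rewrite oCx oCy oCz {1}[#|K|]prod_prime_decomp ?cardG_gt0 // prime_decompE defpi s0.
  by rewrite /= !big_cons big_nil /= muln1 !p_part mulnA.
have class_card a : a \in K -> (#|'C_G[a]| * #|a ^: G| = #|K| * m)%N.
  move=> Ka; rewrite -index_cent1 Lagrange ?subsetIl //.
  by rewrite Lagrange.
have card_x : (#|x ^: G| = m * (#|'C_G[y]| * #|'C_G[z]|))%N.
  apply/eqP; rewrite -(eqn_pmul2l (cardG_gt0 'C_G[x])) class_card // cardK.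
  by apply/eqP; move: #|'C_G[x]| #|'C_G[y]| #|'C_G[z]| (m); clear; lia.
have card_y : (#|y ^: G| = m * (#|'C_G[x]| * #|'C_G[z]|))%N.
  apply/eqP; rewrite -(eqn_pmul2l (cardG_gt0 'C_G[y])) class_card // cardK.
  by apply/eqP; move: #|'C_G[x]| #|'C_G[y]| #|'C_G[z]| (m); clear; lia.
have card_z : (#|z ^: G| = m * (#|'C_G[x]| * #|'C_G[y]|))%N.
  apply/eqP; rewrite -(eqn_pmul2l (cardG_gt0 'C_G[z])) class_card // cardK.
  by apply/eqP; move: #|'C_G[x]| #|'C_G[y]| #|'C_G[z]| (m); clear; lia.
apply: (class_equation_unsolvable (ltnW m_gt1) u_gt1 v_gt1 w_gt1).
rewrite -Du -Dv -Dw -cardK card_K card_x card_y card_z.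
by move: #|'C_G[x]| #|'C_G[y]| #|'C_G[z]| (m); clear; lia.
Qed.

End ThreeNonlinearCharacters.

(** * Star-shaped common non-zero graphs *)

Lemma star_nv_adjP (gT : finGroupType) (G : {group gT}) : is_star (nv_adj G) ->
  exists c : Iirr G, [/\ nonlinear_irr c,
    forall i, nonlinear_irr i -> i != c ->
      exists2 g, g \in vanG G & ('chi_c g != 0) && ('chi_i g != 0)
  & forall i j g, nonlinear_irr i -> nonlinear_irr j -> i != c -> j != c -> i != j ->
      g \in vanG G -> 'chi_i g * 'chi_j g = 0].
Proof.
case=> _ [c [deg_c deg_leaf]].
have adj_c v : v != c -> nv_adj G c v.
  have eq_nbr: [set y | nv_adj G c y] = [set~ c].
    apply/eqP; rewrite eqEcard cardsC1 -deg_c leqnn andbT.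
    by apply/subsetP=> y; rewrite !inE /nv_adj eq_sym => /andP[].
  by move=> ncv; have: v \in [set~ c] by [rewrite !inE]; rewrite -eq_nbr inE.
have leaf_adj v w : v != c -> nv_adj G v w -> w = c.
  move=> ncv vw; have /eqP/cards1P[y nbr_v] := deg_leaf v ncv.
  have: c \in [set y | nv_adj G v y] by rewrite inE nv_adj_sym adj_c.
  have: w \in [set y | nv_adj G v y] by rewrite inE.
  by rewrite nbr_v !inE => /eqP-> /eqP->.
exists (val c); split=> [|i nl_i nci|i j g nl_i nl_j nci ncj nij Vg].
- exact: valP c.
- have /adj_c/andP[_ /exists_inP[g Vg]]: Sub i nl_i != c :> nv_vertex G by rewrite -val_eqE.
  by rewrite mulf_eq0 negb_or; exists g.
apply/eqP; apply: contraT => nz; case/eqP: ncj.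
have ncv: Sub i nl_i != c :> nv_vertex G by rewrite -val_eqE.
have vw: nv_adj G (Sub i nl_i) (Sub j nl_j).
  by rewrite /nv_adj -val_eqE nij /=; apply/exists_inP; exists g.
by rewrite -(leaf_adj _ _ ncv vw).
Qed.

Lemma vanG_in (gT : finGroupType) (G : {group gT}) g : g \in vanG G -> g \in G.
Proof. by case/bigcupP=> k _ /setIdP[]. Qed.

(** * Stars with at least two leaves *)

Section CommonNonZeroStar.

Variables (gT : finGroupType) (G : {group gT}) (c l1 l2 : Iirr G).
Hypotheses (nlc : nonlinear_irr c) (nl1 : nonlinear_irr l1) (nl2 : nonlinear_irr l2).
Hypotheses (nl1c : l1 != c) (nl2c : l2 != c) (nl12 : l1 != l2).
Hypothesis adj_centre : forall i, nonlinear_irr i -> i != c ->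
  exists2 g, g \in vanG G & ('chi[G]_c g != 0) && ('chi_i g != 0).
Hypothesis non_adj : forall i j g,
  nonlinear_irr i -> nonlinear_irr j -> i != c -> j != c -> i != j ->
  g \in vanG G -> 'chi[G]_i g * 'chi_j g = 0.

(** A witness of one leaf is a zero of any other leaf. The centre and a leaf are separated by the
    witness of another leaf, available since there are at least two. *)
Lemma star_same_zeros i j : nonlinear_irr i -> nonlinear_irr j ->
  (forall x, x \in G -> ('chi[G]_i x == 0) = ('chi_j x == 0)) -> i = j.
Proof.
have leaf_leaf u v : nonlinear_irr u -> nonlinear_irr v -> u != c -> v != c ->
  (forall x, x \in G -> ('chi[G]_u x == 0) = ('chi_v x == 0)) -> u = v.
- move=> nlu nlv nuc nvc zuv; apply/eqP; apply: contraT => nuv.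
  have [g Vg /andP[_ nzu]] := adj_centre nlu nuc.
  have /eqP := non_adj nlu nlv nuc nvc nuv Vg.
  by rewrite mulf_eq0 -zuv ?vanG_in // orbb (negPf nzu).
have centre_leaf u : nonlinear_irr u -> u != c ->
  ~ (forall x, x \in G -> ('chi[G]_c x == 0) = ('chi_u x == 0)).
- move=> nlu nuc zcu.
  have [v [nlv nvc nuv]] : exists v, [/\ nonlinear_irr v, v != c & u != v].
    by have [->|] := eqVneq u l1; [exists l2 | exists l1].
  have [g Vg /andP[nzc nzv]] := adj_centre nlv nvc.
  have /eqP := non_adj nlu nlv nuc nvc nuv Vg.
  by rewrite mulf_eq0 -zcu ?vanG_in // (negPf nzc) (negPf nzv).
move=> nli nlj zij; have [eic | nic] := eqVneq i c; have [ejc | njc] := eqVneq j c.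
- by rewrite eic.
- by rewrite eic in zij; case: (centre_leaf j).
- by rewrite ejc in zij; case: (centre_leaf i) => // x Gx; rewrite zij.
exact: leaf_leaf.
Qed.

Lemma star_real i x : nonlinear_irr i -> ('chi[G]_i x)^* = 'chi_i x.
Proof.
move=> nli; have: conjC_Iirr i = i.
  apply: star_same_zeros => // [|y _]; rewrite ?nonlinear_irrE conjC_IirrE.
    by rewrite cfAut_lin_char -nonlinear_irrE.
  by rewrite cfunE conjC_eq0.
by move/(congr1 (fun k => 'chi_k x)); rewrite conjC_IirrE cfunE.
Qed.

(** Some linear ['chi_j] differs from 1 at [x]. Its product with ['chi_i] has the same zeros as
    ['chi_i], hence equals it. *)
Lemma star_off_der i x : nonlinear_irr i -> x \in G -> x \notin G^`(1)%G -> 'chi[G]_i x = 0.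
Proof.
move=> nli Gx; rewrite /= -cap_cfker_lin_irr => /bigcapP notKx.
have [j lin_j nkx] : exists2 j, 'chi[G]_j \is a linear_char & x \notin cfker 'chi_j.
  apply/exists_inP; apply: contraT; rewrite negb_exists_in => /forall_inP kx.
  by case: notKx => j lin_j; have /negbNE := kx j lin_j.
have [k Dk] := irrP (mul_lin_irr lin_j (mem_irr i)).
have Dkx y : 'chi_k y = 'chi_j y * 'chi_i y by rewrite -Dk cfunE.
have Dki: k = i.
  apply: star_same_zeros => // [|y Gy].
    by rewrite /nonlinear_irr Dkx lin_char1 // mul1r.
  by rewrite Dkx mulf_eq0 (negPf (lin_char_neq0 lin_j Gy)).
apply/eqP; have /eqP := Dkx x; rewrite Dki -{1}['chi_i x]mul1r -subr_eq0 -mulrBl mulf_eq0.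
case/orP=> //; rewrite subr_eq0 eq_sym => /eqP jx1; case/negP: nkx.
by rewrite cfkerEirr inE jx1 lin_char1.
Qed.

(** Every leaf vanishes at [gu] or [gv], so column orthogonality retains only the centre and the
    linear characters, which are 1 at both witnesses. *)
Lemma star_leaves_orthogonal u v gu gv :
    nonlinear_irr u -> nonlinear_irr v -> u != c -> v != c -> u != v ->
    gu \in vanG G -> gv \in vanG G -> 'chi_c gu != 0 -> 'chi_c gv != 0 ->
    'chi_u gu != 0 -> 'chi_v gv != 0 ->
  'chi_c gu * 'chi_c gv = - #|G : G^`(1)%G|%:R.
Proof.
move=> nlu nlv nuc nvc nuv Vgu Vgv nzcu nzcv nzu nzv.
have inK g : g \in vanG G -> 'chi_c g != 0 -> g \in G^`(1)%G.
  by move=> Vg; apply: contraR => /star_off_der->; rewrite ?vanG_in.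
have uniq_nz w g k : nonlinear_irr w -> w != c -> g \in vanG G -> 'chi_w g != 0 ->
    nonlinear_irr k -> k != c -> k != w -> 'chi_k g = 0.
  move=> nlw nwc Vg nzw nlk nkc nkw; have /eqP := non_adj nlk nlw nkc nwc nkw Vg.
  by rewrite mulf_eq0 (negPf nzw) orbF => /eqP.
have := second_orthogonality_relation gu (vanG_in Vgv).
have /negPf-> : gu \notin gv ^: G.
  apply: contraNN nzu => /imsetP[z Gz ->]; rewrite cfunJ //.
  by rewrite (uniq_nz v) ?eqxx.
rewrite mulr0n (bigID (fun i => 'chi_i \is a linear_char)) /=.
rewrite (eq_bigr (fun=> 1)) => [|i lin_i]; last first.
  have k1 g : g \in vanG G -> 'chi_c g != 0 -> 'chi_i g = 1.
    move=> Vg nzc; rewrite cfker1 ?lin_char1 //.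
    exact: subsetP (lin_char_der1 lin_i) g (inK g Vg nzc).
  by rewrite !k1 // conjC1 mulr1.
rewrite sumr_const card_lin_irr (bigD1 c) /= -?nonlinear_irrE // big1 => [|i]; last first.
  rewrite -nonlinear_irrE => /andP[nli nic].
  have [eiu | niu] := eqVneq i u; last by rewrite (uniq_nz u) ?mul0r.
  by rewrite [X in _ * X^*](uniq_nz v) ?conjC0 ?mulr0 // eiu.
by rewrite addr0 star_real // => /eqP; rewrite addrC addr_eq0 => /eqP.
Qed.

(** With a third leaf, three real values of ['chi_c] would have all pairwise products equal to the
    same negative number. *)
Lemma star_three_nonlinear i : nonlinear_irr i = (i \in [:: c; l1; l2]).
Proof.
rewrite !inE; apply/idP/or3P=> [nli | [] /eqP-> //].
have [_ | nic] := eqVneq i c; first by constructor 1.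
have [_ | ni1] := eqVneq i l1; first by constructor 2.
have [_ | ni2] := eqVneq i l2; first by constructor 3.
have [g Vg /andP[cg ig]] := adj_centre nli nic.
have [g1 Vg1 /andP[cg1 l1g1]] := adj_centre nl1 nl1c.
have [g2 Vg2 /andP[cg2 l2g2]] := adj_centre nl2 nl2c.
have e1 := star_leaves_orthogonal nli nl1 nic nl1c ni1 Vg Vg1 cg cg1 ig l1g1.
have e2 := star_leaves_orthogonal nli nl2 nic nl2c ni2 Vg Vg2 cg cg2 ig l2g2.
have e12 := star_leaves_orthogonal nl1 nl2 nl1c nl2c nl12 Vg1 Vg2 cg1 cg2 l1g1 l2g2.
have eg: 'chi_c g1 = 'chi_c g2 by apply: (mulfI cg); rewrite e1 e2.
have: 0 <= 'chi_c g1 * 'chi_c g2 by rewrite eg -{2}star_real // mul_conjC_ge0.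
by rewrite e12 oppr_ge0 lern0 -leqn0 leqNgt indexg_gt0.
Qed.

Lemma star_two_leaves_False : False.
Proof.
have [g1 Vg1 /andP[cg1 l1g1]] := adj_centre nl1 nl1c.
have [g2 Vg2 /andP[cg2 l2g2]] := adj_centre nl2 nl2c.
have leaves x : x \in vanG G -> 'chi_l1 x * 'chi_l2 x = 0 by exact: non_adj.
have l2g1: 'chi_l2 g1 = 0.
  by have /eqP := leaves g1 Vg1; rewrite mulf_eq0 (negPf l1g1) => /eqP.
have l1g2: 'chi_l1 g2 = 0.
  by have /eqP := leaves g2 Vg2; rewrite mulf_eq0 (negPf l2g2) orbF => /eqP.
have uniq3: uniq [:: c; l1; l2] by rewrite /= !inE negb_or !(eq_sym c) nl1c nl2c nl12.
apply: (three_nonlinear_irr_False star_three_nonlinear uniq3 star_real star_off_der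
  (vanG_in Vg1) (vanG_in Vg2) cg1 l1g1 l2g1 cg2 l2g2 l1g2 leaves).
Qed.

End CommonNonZeroStar.

Theorem theoremD (gT : finGroupType) (G : {group gT}) :
  is_star (nv_adj G) -> #|[set i : Iirr G | nonlinear_irr i]| = 1%N.
Proof.
case/star_nv_adjP=> c [nlc adj_centre non_adj].
suffices only_c i : nonlinear_irr i -> i = c.
  apply/eqP/cards1P; exists c; apply/setP=> i; rewrite !inE.
  by apply/idP/eqP=> [/only_c | ->].
move=> nli; apply/eqP; apply: contraT => nic.
have [g Vg /andP[cg ig]] := adj_centre i nli nic.
(* A character vanishing at the witness [g] is nonlinear and differs from both [c] and [i]: it is a
   second leaf. *)
have [k _ /setIdP[Gg /eqP kg]] := bigcupP Vg.
have nlk: nonlinear_irr k.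
  rewrite nonlinear_irrE; apply/negP=> lin_k.
  by have := lin_char_neq0 lin_k Gg; rewrite kg eqxx.
have nkc: k != c by apply: contraNneq cg => <-; rewrite kg.
have nik: i != k by apply: contraNneq ig => ->; rewrite kg.
by case: (star_two_leaves_False nlc nli nlk nic nkc nik adj_centre non_adj).
Qed.
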